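(* Let $L$ be the Kreweras–Lalanne involution on Dyck paths, $L'$ its derivative, and $R$ the ''reverse path'' involution. For every $n$, on the set of Dyck $n$-paths, $$(L'\circ L)^{n}=R.$$
   Context: A Dyck path is a lattice path with an equal number of upsteps $u=(1,1)$ and downsteps $d=(1,-1)$ that never dips below ground level, the horizontal line connecting its endpoints. Its size is its number of upsteps; a Dyck $n$-path is one of size $n$. The empty Dyck path is denoted $\epsilon$. A Dyck path is elevated if it is nonempty and its only return to ground level occurs at its end. Every nonempty Dyck path decomposes uniquely as a concatenation of elevated Dyck paths, called its components; each component has the form $u\,P\,d$ with $P$ a (possibly empty) Dyck path. Composition is $(f\circ g)(x)=f(g(x))$, and $(L'\circ L)^n$ is the $n$-fold composition. Partial-sum ascent-descent code. An ascent (descent) is a maximal sequence of contiguous upsteps (downsteps). For $n\ge 1$, let a Dyck $n$-path have $k$ peaks (occurrences of $ud$), ascent lengths $a_1,\dots,a_k$ and descent lengths $d_1,\dots,d_k$, in order. Put $r=k-1$, $A_i=\sum_{j\le i}a_j$ and $D_i=\sum_{j\le i}d_j$. The code of the path is the pair $\big((A_i)_{i=1}^{r},(D_i)_{i=1}^{r}\big)$. For given $n$ the path is determined by its code, and the codes of Dyck $n$-paths are exactly the pairs with $0\le r\le n-1$, $1\le A_1<\cdots<A_r\le n-1$, $1\le D_1<\cdots<D_r\le n-1$, and $A_i\ge D_i$ for $1\le i\le r$. Involution $L$. For a Dyck $n$-path $P$ with $n\ge 1$, label the upsteps $1,\dots,n$ from left to right and the downsteps $1,\dots,n$ from left to right.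 Let $D$ be the increasing sequence of labels of the first $u$ in each occurrence of $uu$ (two consecutive upsteps), and let $A$ be the increasing sequence of labels of the first $d$ in each occurrence of $dd$. These have the same length, and $(A,D)$ is a valid code. $L(P)$ is the Dyck $n$-path whose partial-sum ascent-descent code is $(A,D)$. Also $L(\epsilon)=\epsilon$. Derivative. $L'$ is defined by $L'(\epsilon)=\epsilon$ and $L'(uP_1d\;uP_2d\cdots uP_\ell d)=uL(P_1)d\;uL(P_2)d\cdots uL(P_\ell)d$, where $uP_1d,\dots,uP_\ell d$ are the components of the path. Reverse path. $R$ sends a Dyck path to its mirror image in a vertical line: the word in $u,d$ is read backwards and $u$ and $d$ are interchanged. *)

(* Defs.v *)
From mathcomp Require Import all_boot.

Set Implicit Arguments.
Unset Strict Implicit.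
Unset Printing Implicit Defensive.

(* Lattice paths are words over bool: true is the upstep u = (1,1), false is  *)
(* the downstep d = (1,-1).                                                   *)
Notation ustep := true (only parsing).
Notation dstep := false (only parsing).

Definition is_dyck (p : seq bool) : bool :=
  (count_mem ustep p == count_mem dstep p) &&
  all (fun i => count_mem dstep (take i p) <= count_mem ustep (take i p))
      (iota 0 (size p).+1).

Definition dyck (n : nat) (p : seq bool) : bool :=
  is_dyck p && (count_mem ustep p == n).

(* Maximal constant factors of p, as pairs (step, length). *)
Fixpoint runs (p : seq bool) : seq (bool * nat) :=
  if p is s :: p' then
    match runs p' with
    | (t, m) :: r => if s == t then (t, m.+1) :: r else (s, 1) :: (t, m) :: r
    | [::] => [:: (s, 1)]
    end
  else [::].

(* Ascent lengths for s = ustep, descent lengths for s = dstep. *)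
Definition run_lengths (s : bool) (p : seq bool) : seq nat :=
  [seq r.2 | r <- runs p & r.1 == s].

Definition proper_partial_sums (l : seq nat) : seq nat :=
  [seq sumn (take i l) | i <- iota 1 (size l).-1].

Definition code (p : seq bool) : seq nat * seq nat :=
  (proper_partial_sums (run_lengths ustep p),
   proper_partial_sums (run_lengths dstep p)).

Definition differences (l : seq nat) : seq nat :=
  pairmap (fun x y => y - x) 0 l.

(* The path of size n with code (A, D): the omitted last partial sums are both *)
(* n, and the lengths of the runs are the successive differences (see          *)
(* code_path_of_code below).                                                   *)
Definition path_of_code (n : nat) (A D : seq nat) : seq bool :=
  flatten [seq nseq ad.1 ustep ++ nseq ad.2 dstep
          | ad <- zip (differences (rcons A n)) (differences (rcons D n))].

(* Labels of the first s in each occurrence of ss.  The s-step at position i  *)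
(* (from 0) has label count_mem s (take i.+1 p); the default ~~ s of nth      *)
(* excludes the last position.                                                *)
Definition double_labels (s : bool) (p : seq bool) : seq nat :=
  [seq count_mem s (take i.+1 p)
  | i <- iota 0 (size p)
  & (nth (~~ s) p i == s) && (nth (~~ s) p i.+1 == s)].

(* The first component of the new code comes from the downsteps and the second *)
(* from the upsteps.  On the empty path this yields the empty path.            *)
Definition L (p : seq bool) : seq bool :=
  path_of_code (count_mem ustep p)
    (double_labels dstep p) (double_labels ustep p).

(* h is the current height and acc the part already read of the component     *)
(* being scanned.                                                             *)
Fixpoint components_rec (h : nat) (acc p : seq bool) : seq (seq bool) :=
  if p is s :: p' then
    let h' := if s then h.+1 else h.-1 in
    if h' == 0 then rcons acc s :: components_rec 0 [::] p'
    else components_rec h' (rcons acc s) p'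
  else [::].

Definition components (p : seq bool) : seq (seq bool) :=
  components_rec 0 [::] p.

Definition elevate (p : seq bool) : seq bool := ustep :: rcons p dstep.

(* Left inverse of elevate. *)
Definition interior (c : seq bool) : seq bool :=
  take (size c).-2 (behead c).

Definition L' (p : seq bool) : seq bool :=
  flatten [seq elevate (L (interior c)) | c <- components p].

Definition R (p : seq bool) : seq bool := rev (map negb p).

Lemma runs_nseq s m p :
  head (~~ s) p = ~~ s -> runs (nseq m.+1 s ++ p) = (s, m.+1) :: runs p.
Proof.
have runs_cons t q : exists k r, runs (t :: q) = (t, k) :: r.
  rewrite /=; case: (runs q) => [|[t' k] r]; first by exists 1, [::].
  by case: eqP => [<-|_]; [exists k.+1, r | exists 1, ((t', k) :: r)].
move=> hp; elim: m => [|m IHm]; last first.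
  rewrite -[nseq _ _ ++ p]/(s :: (nseq m.+1 s ++ p)).
  by move: (nseq m.+1 s ++ p) IHm => q /= ->; rewrite eqxx.
case: p hp => [//|t q] /= ->.
have [k [r /= ->]] := runs_cons (~~ s) q.
by case: s.
Qed.

Lemma run_lengths_zigzag (a d : seq nat) :
    size a = size d -> all (ltn 0) a -> all (ltn 0) d ->
  let p := flatten [seq nseq ad.1 ustep ++ nseq ad.2 dstep | ad <- zip a d] in
  run_lengths ustep p = a /\ run_lengths dstep p = d.
Proof.
rewrite /run_lengths.
elim: a d => [|x a IHa] [|y d] //= [ad] /andP[x0 a0] /andP[y0 d0].
have := IHa d ad a0 d0; set p := flatten _ => /= -[pa pd].
have hp : head ustep p = ustep.
  by rewrite /p; case: (a) (d) ad a0 => [|[|x'] a'] [|y' d'].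
case: x y x0 y0 => [|x] [|y] // _ _.
by rewrite -catA runs_nseq // runs_nseq //= pa pd.
Qed.

Lemma differences_gt0 x l :
  path ltn x l -> all (ltn 0) (pairmap (fun x y => y - x) x l).
Proof. by elim: l x => //= y l IHl x /andP[xy /IHl ->]; rewrite subn_gt0 xy. Qed.

Lemma proper_partial_sums_differences n A :
  path ltn 0 (rcons A n) -> proper_partial_sums (differences (rcons A n)) = A.
Proof.
have sum_take l x i : path ltn x l -> i < size l ->
    x + sumn (take i.+1 (pairmap (fun x y => y - x) x l)) = nth 0 l i.
  elim: l x i => [//|y l IHl] x i /= /andP[xy yl].
  case: i => [_|i] /=; first by rewrite take0 /= addn0 subnKC // ltnW.
  by move=> il; rewrite addnA subnKC ?(ltnW xy) // IHl.
move=> An; rewrite /proper_partial_sums /differences size_pairmap size_rcons /=.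
apply: (@eq_from_nth _ 0) => [|i]; rewrite size_map size_iota // => iA.
rewrite (nth_map 0) ?size_iota // nth_iota // -[sumn _]add0n.
by rewrite sum_take ?size_rcons ?nth_rcons ?iA // ltnW.
Qed.

Lemma code_path_of_code n A D :
    size A = size D -> path ltn 0 (rcons A n) -> path ltn 0 (rcons D n) ->
  code (path_of_code n A D) = (A, D).
Proof.
move=> eqAD An Dn; rewrite /code /path_of_code.
have [||| -> ->] :=
  @run_lengths_zigzag (differences (rcons A n)) (differences (rcons D n)).
- by rewrite !size_pairmap !size_rcons eqAD.
- exact: differences_gt0.
- exact: differences_gt0.
by rewrite !proper_partial_sums_differences.
Qed.

Lemma components_rec_cat h acc p q :
    (forall i, i <= size p ->
       count_mem dstep (take i p) <= h + count_mem ustep (take i p)) ->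
    count_mem dstep p = h + count_mem ustep p ->
  components_rec h.+1 acc (p ++ dstep :: q)
    = (acc ++ rcons p dstep) :: components_rec 0 [::] q.
Proof.
elim: p h acc => [|s p IHp] h acc hpre /=.
  by rewrite addn0 => <-; rewrite cats1.
case: s hpre => hpre /=; rewrite ?add0n ?add1n => hp.
  rewrite IHp ?cat_rcons ?hp ?addnS ?addSn // => i ip.
  by have := hpre i.+1 ip; rewrite /= add1n add0n addnS addSn.
case: h hpre hp => [|h] hpre hp; first by have := hpre 1 isT; rewrite /= take0.
rewrite /= IHp ?cat_rcons //; last by case: hp.
by move=> i ip; have := hpre i.+1 ip; rewrite /= add1n add0n addSn.
Qed.

Lemma components_flatten Ps :
  all is_dyck Ps -> components (flatten (map elevate Ps)) = map elevate Ps.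
Proof.
elim: Ps => //= P Ps IHPs /andP[/andP[/eqP eqP /allP preP] /IHPs{}IHPs].
rewrite -{2}IHPs /components /= cat_rcons components_rec_cat //.
by move=> i iP; apply: preP; rewrite mem_iota.
Qed.

(* The defining equation of the derivative. *)
Lemma L'_flatten Ps :
    all is_dyck Ps ->
  L' (flatten (map elevate Ps)) = flatten [seq elevate (L P) | P <- Ps].
Proof.
move=> /components_flatten; rewrite /L' => ->; rewrite -map_comp.
congr flatten; apply: eq_map => P /=; congr (elevate (L _)).
by rewrite /interior /= size_rcons /= -cats1 take_size_cat.
Qed.

(* Main.v *)
Require Import Defs.
From mathcomp Require Import all_boot.
From mathcomp Require Import order ssralg ssrnum ssrint zify.

(** Encode a Dyck path of size n > 0 by two words: c records the step that
follows each upstep, e the step that follows each downstep (with a downstep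
after the end of the path).  The path is recovered from c and e
([follow_inj]).  Apart from the last place, the labels of uu and dd are the
places where c has u and e has d; hence L just exchanges c and e ([follow_L]).

Weaving the two words into u c1 e1 c2 e2 ... cn gives another Dyck path of size
n, the woven path ([weave], [dyck_weave]).  In terms of it the three maps become
local or geometric:
- L exchanges c_i with e_i, which turns peaks into valleys and vice versa at the
  even abscissas of the woven path ([weave_L]);
- weaving is compatible with concatenation, and sends u P d to u w d with w the
  woven path of L(P); hence L' turns peaks into valleys and vice versa at the
  odd abscissas, except that a peak whose two neighbours are on the ground stays
  ([weave_L']);
- R reverses the woven path ([weave_R]).

If h(t, i) is the height at abscissa i of the woven path after t steps L, L', L,
..., then in all cases, for i of the parity of t and 0 < i < 2n,
  h(t+1, i) = | h(t, i-1) + h(t, i+1) - h(t, i) |.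
Without the absolute value this is the discrete wave equation on a string with
fixed ends, whose solutions come back after 2n steps reversed and negated; with
the absolute value they come back reversed ([wave_reversal]).  To see this, put
u(x, y) = h(x+y, y-x) and let f(y) = u(a, y).  Then u(x, y) is the distance
between x and y in the plane tree with contour f, namely
f(x) + f(y) - 2 min f over [x, y].  In particular u(x, a+2n) = f(x) = u(a, x),
and this is the reversal.

The argument needs the row u(a, .) for the point u(a, x) under consideration, so
it requires some past of the point.  As L' o L is invertible on Dyck paths, any
path is the n-th iterate of another one, which provides this past. *)

Set Implicit Arguments.
Unset Strict Implicit.
Unset Printing Implicit Defensive.

Import Order.TTheory GRing.Theory Num.Theory.
Local Open Scope ring_scope.

(** * The reflected discrete wave equation *)

Fixpoint run_min (f : nat -> int) (k d : nat) : int :=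
  if d is d'.+1 then Order.min (run_min f k d') (f (k + d)%N) else f k.

Lemma run_min_recl f k d :
  run_min f k d.+1 = Order.min (f k) (run_min f k.+1 d).
Proof.
elim: d => [|d IHd]; first by rewrite /= addn1.
by rewrite -[LHS]/(Order.min (run_min f k d.+1) _) IHd /= minA addSnnS.
Qed.

Lemma run_min_le f k d :
  (run_min f k d <= f k) && (run_min f k d <= f (k + d)%N).
Proof.
elim: d => [|d]; rewrite /= ?addn0 ?lexx // => /andP[fk _].
by rewrite !ge_min fk lexx orbT.
Qed.

Section Wave.

Variables (m : nat) (h : nat -> nat -> int).
Hypothesis even_m : ~~ odd m.
Hypothesis h_left : forall t, h t 0 = 0.
Hypothesis h_right : forall t, h t m = 0.
Hypothesis h_ge0 : forall t i, (i <= m)%N -> 0 <= h t i.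
Hypothesis h_step : forall t i, (i < m)%N -> `|h t i.+1 - h t i| = 1.
Hypothesis h_still : forall t i, (i <= m)%N ->
  odd t != odd i -> h t.+1 i = h t i.
Hypothesis h_wave : forall t i, (0 < i < m)%N -> odd t == odd i ->
  h t.+1 i = `|h t i.-1 + h t i.+1 - h t i|.

(** The light-cone coordinates are x = a + k and y = a + b: a point with k <= b
lies at time x + y and place y - x.  The row k = 0 starts at the left end of the
string at time a + a, and serves as contour of the tree in u_tree. *)
Let u a k b := h (a + k + (a + b)) (b - k).

Let u_rule a k b : (k < b)%N -> (b < k + m)%N ->
  u a k.+1 b.+1 = `|u a k.+1 b + u a k b.+1 - u a k b|.
Proof.
move=> kb bm; rewrite /u.
have ->: (a + k.+1 + (a + b.+1) = (a + k + (a + b)).+2)%N by lia.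
have ->: (a + k + (a + b.+1) = (a + k + (a + b)).+1)%N by lia.
have ->: (a + k.+1 + (a + b) = (a + k + (a + b)).+1)%N by lia.
rewrite h_still; try lia.
have ->: (b.+1 - k.+1 = b - k)%N by lia.
rewrite h_wave; try lia.
rewrite !h_still; try lia.
by congr (`| h _ _ + h _ _ - _|); lia.
Qed.

(** The tree distance satisfies u_rule.  Write mu for the minimum over
[k+1, b].  If f k >= mu or f (b+1) >= mu, the minima of the four intervals
cancel as in the wave equation without absolute value.  Otherwise f k and
f (b+1) both equal mu - 1, so u k b.+1 = 0 and the wave bounces on the
ground. *)
Let u_tree a k d : (k + d <= m)%N ->
  u a k (k + d) = u a 0 k + u a 0 (k + d) - run_min (u a 0) k d *+ 2.
Proof.
have f0 : u a 0 0 = 0 by rewrite /u h_left.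
have f_ge0 b : (b <= m)%N -> 0 <= u a 0 b by move=> ?; rewrite /u h_ge0 //; lia.
have f_step b : (b < m)%N -> `|u a 0 b.+1 - u a 0 b| = 1.
  move=> bm; rewrite /u !subn0 addnS addnS h_still; try lia.
  exact: h_step.
elim: k d => [|k IHk] d.
  move=> dm; rewrite add0n f0 add0r.
  suff ->: run_min (u a 0) 0 d = 0 by rewrite mul0rn subr0.
  elim: d dm => [|d IHd] dm //=; rewrite IHd ?add0n; [|lia].
  by have := f_ge0 _ dm; rewrite add0n; lia.
elim: d => [|d IHd] km.
  by rewrite addn0 /u subnn h_left /=; lia.
rewrite addnS u_rule; try lia.
rewrite IHd; last lia.
have := IHk d.+2 ltac:(lia); have := IHk d.+1 ltac:(lia).
rewrite [run_min _ k d.+1]run_min_recl [run_min _ k d.+2]run_min_recl.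
rewrite !addnS addSn => -> ->.
rewrite /=; have /= := run_min_le (u a 0) k.+1 d.
have := f_step k ltac:(lia); have := f_step (k + d).+1 ltac:(lia).
by rewrite !addSn !addnS; lia.
Qed.

(** The bound m <= t ensures that the row through (t, i) starts at a nonnegative
time.  On that row the end y = a + m has height 0 and minimum 0, so the tree
distance to it is the contour itself. *)
Lemma wave_reversal t i :
  (m <= t)%N -> (i <= m)%N -> h (t + m) (m - i) = h t i.
Proof.
have main t' i' : (m <= t')%N -> (i' <= m)%N -> odd t' = odd i' ->
    h (t' + m) (m - i') = h t' i'.
  move=> mt im ti; pose a := (t' - i')./2.
  have ta : t' = (a + a + i')%N by rewrite /a; lia.
  have := @u_tree a i' (m - i')%N ltac:(lia).
  have ->: run_min (u a 0) i' (m - i') = 0.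
    case: (m - i')%N (subnKC im) => [|d] im'.
      by rewrite /= /u -[i']addn0 im' subn0 h_right.
    have mge : forall e k, (k + e <= m)%N -> 0 <= run_min (u a 0) k e.
      elim=> [|e IHe] k ke /=; first by rewrite /u h_ge0 //; lia.
      by rewrite le_min IHe ?/u ?h_ge0 //; lia.
    have := mge d.+1 i' ltac:(lia); have := run_min_le (u a 0) i' d.+1.
    have ->: u a 0 (i' + d.+1) = 0 by rewrite im' /u subn0 h_right.
    lia.
  rewrite subnKC // /u !subn0 h_right mul0rn subr0 addr0 addn0.
  move=> hu; rewrite {2}ta -addnA -hu; congr h; lia.
move=> mt im; case: (odd t =P odd i) => ti; first exact: main.
rewrite -(h_still (i := i)) //; last by apply/eqP.
rewrite -(h_still (t := t + m)); try lia.
by rewrite -addSn main //; lia.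
Qed.

End Wave.

(** * The steps that follow upsteps and downsteps *)

Definition step (b : bool) : int := if b then 1 else -1.

Fixpoint height (w : seq bool) : int :=
  if w is b :: w' then step b + height w' else 0.

Lemma height_cat v w : height (v ++ w) = height v + height w.
Proof. by elim: v => [|b v IHv] /=; rewrite ?add0r // IHv addrA. Qed.

Lemma height_rcons w b : height (rcons w b) = height w + step b.
Proof. by rewrite -cats1 height_cat /= addr0. Qed.

Lemma height_le_size w : height w <= (size w)%:Z.
Proof. by elim: w => //= -[] w IHw; rewrite /step /=; lia. Qed.

Lemma heightE w : height w = (count_mem ustep w)%:Z - (count_mem dstep w)%:Z.
Proof. by elim: w => //= -[] w ->; rewrite /step /=; lia. Qed.

Lemma size_steps w : (count_mem ustep w + count_mem dstep w)%N = size w.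
Proof.
rewrite -(count_predC (pred1 ustep)); congr (_ + _)%N.
by apply: eq_count => -[].
Qed.

Lemma height_take_dyck p :
  is_dyck p <-> height p = 0 /\ forall i, 0 <= height (take i p).
Proof.
rewrite /is_dyck heightE; split=> [/andP[/eqP eqp /allP pre]|[eqp pre]].
  split=> [|i]; first by rewrite eqp subrr.
  rewrite heightE; case: (leqP i (size p)) => ip.
    by have := pre i; rewrite mem_iota; lia.
  by rewrite take_oversize ?eqp ?subrr // ltnW.
apply/andP; split; first by lia.
by apply/allP=> i _; have := pre i; rewrite heightE; lia.
Qed.

(** The steps of p that follow an s, in order; y stands for the step after the
end of p. *)
Fixpoint nexts (y s : bool) (p : seq bool) : seq bool :=
  if p is x :: p' then
    if x == s then head y p' :: nexts y s p' else nexts y s p'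
  else [::].

Lemma size_nexts y s p : size (nexts y s p) = count_mem s p.
Proof. by elim: p => //= x p <-; case: (x == s). Qed.

Lemma nexts_cat y s p q :
  nexts y s (p ++ q) = nexts (head y q) s p ++ nexts y s q.
Proof. by elim: p => //= x p ->; case: (x == s); case: p. Qed.

Lemma nexts_rcons y s p z :
  nexts y s (rcons p z) = nexts z s p ++ (if z == s then [:: y] else [::]).
Proof. by rewrite -cats1 nexts_cat. Qed.

(** Reading p from its head, each letter says in which word to look up the next
one. *)
Lemma nexts_inj y p q :
    head y p = head y q ->
    nexts y ustep p = nexts y ustep q -> nexts y dstep p = nexts y dstep q ->
  p = q.
Proof.
elim: p q => [|x p IHp] [|x' q] //=.
- by move=> _; case: x'.
- by move=> _; case: x.
by move=> <-; case: x => /=; [case=> ? ? ?|move=> ? [? ?]]; rewrite (IHp q).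
Qed.

(** The two words together consist of the letters of p without the first one,
and of y. *)
Lemma height_nexts y p :
  height (nexts y ustep p) + height (nexts y dstep p) =
  height p - step (head y p) + step y.
Proof.
elim: p => /= [|x p IHp]; first by lia.
by case: x => /=; lia.
Qed.

Lemma last_nexts_up p : last dstep (nexts dstep ustep p) = dstep.
Proof.
have noup q : nexts dstep ustep q = [::] -> head dstep q = dstep.
  by case: q => [|[] q].
elim: p => //= -[] p IHp //=.
by case: (nexts _ _ p) IHp (@noup p) => [|z r] // _ ->.
Qed.

(** For a Dyck path the last upstep and the last downstep are both followed by a
downstep, by the convention on the end of the path.  That letter carries no
information and is left out of c and e, whose size n is one less than that of
the path. *)
Definition follow n p c e :=
  [/\ head dstep p = ustep, nexts dstep ustep p = rcons c dstep,
      nexts dstep dstep p = rcons e dstep, size c = n & size e = n].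

(** The condition on codes that the i-th partial sums satisfy A_i >= D_i.  It is
symmetric in the two words. *)
Definition admissible c e :=
  forall x, 0 <= height (take x c) + height (take x e).

Lemma follow_count n p c e : follow n p c e ->
  count_mem ustep p = n.+1 /\ count_mem dstep p = n.+1.
Proof.
case=> _ hc he sc se.
rewrite -(size_nexts dstep ustep) -(size_nexts dstep dstep) hc he.
by rewrite !size_rcons sc se.
Qed.

Lemma follow_height n p c e : follow n p c e -> height c + height e = 0.
Proof.
move=> hf; have [cu cd] := follow_count hf; case: hf => hp hc he _ _.
have := height_nexts dstep p.
by rewrite hp hc he !height_rcons (heightE p) cu cd /step /=; lia.
Qed.

Lemma follow_inj n p q c e : follow n p c e -> follow n q c e -> p = q.
Proof.
by case=> h1 h2 h3 _ _ [h4 h5 h6 _ _]; apply: (@nexts_inj dstep); congruence.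
Qed.

Lemma dyck_ends n p : dyck n.+1 p -> exists w, p = ustep :: rcons w dstep.
Proof.
case/andP=> /height_take_dyck[p0 pre] /eqP.
case: p p0 pre => [|x p] //= p0 pre _.
have x1: x = ustep by have := pre 1%N; rewrite /= take0 /=; case: (x).
case/lastP: p p0 pre => [|w z]; first by rewrite x1.
move=> p0 /(_ (size w).+1).
rewrite /= -[in take _ _]cats1 take_size_cat // => pre.
exists w; rewrite x1; congr (_ :: rcons _ _).
by move: p0 pre; rewrite height_rcons; case: z => //; rewrite /step /=; lia.
Qed.

Lemma ends_dstep n (s : seq bool) : size s = n.+1 -> last dstep s = dstep ->
  exists2 s', s = rcons s' dstep & size s' = n.
Proof.
case/lastP: s => // s z; rewrite size_rcons last_rcons => -[sn] ->.
by exists s.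
Qed.

Lemma dyck_follow n p : dyck n.+1 p -> exists c e, follow n p c e.
Proof.
move=> pd; have [w pw] := dyck_ends pd.
case/andP: pd => /andP[/eqP eqp _] /eqP cu.
have [||c hc sc] := @ends_dstep n (nexts dstep ustep p).
- by rewrite size_nexts.
- exact: last_nexts_up.
have [||e he se] := @ends_dstep n (nexts dstep dstep p).
- by rewrite size_nexts -eqp.
- by rewrite pw -cat1s nexts_cat nexts_rcons !last_cat.
by exists c, e; split; rewrite // pw.
Qed.

Lemma prefix_count (s : bool) p x : (0 < x <= count_mem s p)%N ->
  exists w v, p = rcons w s ++ v /\ count_mem s w = x.-1.
Proof.
elim: p x => [|z p IHp] x /=; first by case: x.
case: eqP => [-> |zs] /=; last first.
  case/IHp=> [w [v [-> cw]]]; exists (z :: w), v; split=> //=.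
  by rewrite cw; case: eqP zs.
case: x => [|[|x]] //= hx; first by exists [::], p.
have [|w [v [pE cw]]] := IHp x.+1; first by rewrite add1n ltnS in hx.
by exists (s :: w), v; rewrite pE /= eqxx cw.
Qed.

Lemma follow_prefix n p c e w v : follow n p c e -> p = w ++ v ->
  nexts (head dstep v) ustep w = take (count_mem ustep w) (rcons c dstep) /\
  nexts (head dstep v) dstep w = take (count_mem dstep w) (rcons e dstep).
Proof.
case=> _ hc he _ _ pE.
by rewrite -hc -he pE !nexts_cat -!(size_nexts (head dstep v)) !take_size_cat.
Qed.

(** Apply height_nexts to a prefix w of p that contains i upsteps and j
downsteps: it gives the height of the first i letters of the one word plus that
of the first j letters of the other.  If p is a Dyck path and w ends with the
downstep number x, then i >= x, and the letters of c between x and i contribute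
at most i - x, or at most i - x - 2 when w is followed by a downstep.
Conversely, if p is about to go below the ground after w, then i = j and the sum
of the two heights is negative. *)
Lemma follow_dyck n p c e : follow n p c e -> dyck n.+1 p <-> admissible c e.
Proof.
move=> hf; have [cu cd] := follow_count hf; have b0 := follow_height hf.
have [hp hc he sc se] := hf.
rewrite /dyck cu eqxx andbT; rewrite height_take_dyck heightE cu cd subrr.
split=> [[_ pre] x|adm].
  case: (ltnP x n) => [xn|nx]; last by rewrite !take_oversize ?b0 ?sc ?se.
  case: x xn => [|x] xn; first by rewrite !take0.
  have [|w [v [pE cw]]] := @prefix_count dstep p x.+1; first by lia.
  have [hcw hew] := follow_prefix hf pE.
  have := pre (size (rcons w dstep)); rewrite pE take_size_cat // heightE.
  have := height_nexts (head dstep v) (rcons w dstep).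
  rewrite hcw hew (heightE (rcons w dstep)).
  have -> : head (head dstep v) (rcons w dstep) = ustep.
    by move: hp; rewrite pE; case: (w).
  have cdw: count_mem dstep (rcons w dstep) = x.+1.
    by rewrite -cats1 count_cat /= cw addn1.
  rewrite cdw; set i := count_mem ustep (rcons w dstep) => hb ix.
  have xi : (x.+1 <= i)%N by lia.
  have iN : (i <= n.+1)%N by rewrite -cu pE count_cat leq_addr.
  (* the last upstep of w comes just before its final run of downsteps *)
  have last_up : head dstep v = dstep ->
      last dstep (take i (rcons c dstep)) = dstep.
    by move=> vd; rewrite -hcw vd nexts_rcons cats0 last_nexts_up.
  have ix2 : head dstep v = dstep -> (x.+2 <= i)%N.
    case: (v) pE => [|z v'] pE.
      by move: cd; rewrite pE cats0 cdw; lia.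
    move=> /= zd; have := pre (size (rcons w dstep)).+1.
    rewrite pE -cat_rcons -(size_rcons _ z) take_size_cat // height_rcons.
    by rewrite (heightE (rcons w dstep)) cdw zd -/i /step; lia.
  have te : take x.+1 (rcons e dstep) = take x.+1 e.
    by rewrite -cats1 takel_cat // se ltnW.
  move: hb last_up; rewrite te; set t := take i _.
  have -> : t = take x.+1 c ++ drop x.+1 t.
    rewrite -{1}(cat_take_drop x.+1 t) take_takel // -cats1 takel_cat //.
    by rewrite sc ltnW.
  have st : size (drop x.+1 t) = (i - x.+1)%N.
    by rewrite size_drop size_takel // size_rcons sc.
  rewrite height_cat; case: (head dstep v) ix2 => /= ix2 hb last_up.
    have := height_le_size (drop x.+1 t); rewrite st.
    by move: hb; rewrite /step; lia.
  have {}last_up := last_up erefl; have {}ix2 := ix2 erefl.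
  case/lastP: (drop _ _) st hb last_up => [|r z]; first by move=> /= ?; lia.
  rewrite size_rcons last_cat last_rcons height_rcons => sr hb zd.
  by have := height_le_size r; move: hb; rewrite zd /step; lia.
split=> //.
elim=> [|i IHi]; first by rewrite take0.
case: (ltnP i (size p)) => ip; last first.
  by rewrite take_oversize ?heightE ?cu ?cd ?subrr // ltnW.
rewrite (take_nth dstep) // height_rcons.
have pE := cat_take_drop i p; rewrite (drop_nth dstep) // in pE.
case: (nth dstep p i) pE; first by rewrite /step; lia.
move/esym=> pE; have [hu hd] := follow_prefix hf pE.
have := height_nexts dstep (take i p); move: hu hd => /= -> ->.
have ih : head dstep (take i p) = ustep.
  by move: hp; rewrite {1}pE; case: (take i p).
have ui : (count_mem ustep (take i p) <= n.+1)%N.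
  by rewrite -cu {2}pE count_cat leq_addr.
have di : (count_mem dstep (take i p) < n.+1)%N.
  by rewrite -cd {2}pE count_cat /= addnCA leq_addr.
move: IHi; rewrite ih (heightE (take i p)).
have := adm (count_mem dstep (take i p)).
case: (ltngtP (count_mem dstep (take i p)) (count_mem ustep (take i p))) => ud;
  rewrite /step; try lia.
by rewrite -ud -!cats1 !takel_cat ?sc ?se // /=; lia.
Qed.

(** * The involution exchanges the two words *)

(** In nexts (~~ s) s p the letter number x is s when the x-th s of p is the
first letter of an occurrence of ss; the default excludes the last step of p. *)
Lemma double_labels_mask s p :
  double_labels s p =
  mask [seq z == s | z <- nexts (~~ s) s p] (iota 1 (count_mem s p)).
Proof.
rewrite /double_labels.
suff main k : [seq (k + count_mem s (take i.+1 p))%N | i <- iota 0 (size p)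
    & (nth (~~ s) p i == s) && (nth (~~ s) p i.+1 == s)] =
    mask [seq z == s | z <- nexts (~~ s) s p] (iota k.+1 (count_mem s p)).
  by rewrite -main.
elim: p k => //= x p IHp k.
rewrite nth0 -[1%N]addn0 iotaDl filter_map.
have tailE : [seq (k + ((x == s) + count_mem s (take i p)))%N
     | i <- [seq (1 + i)%N | i <- iota 0 (size p)
     & preim (addn 1)
         (fun i => (nth (~~ s) (x :: p) i == s) && (nth (~~ s) p i == s)) i]] =
  [seq (k + (x == s) + count_mem s (take i.+1 p))%N | i <- iota 0 (size p)
    & (nth (~~ s) p i == s) && (nth (~~ s) p i.+1 == s)].
  by rewrite -map_comp; apply: eq_map => i /=; rewrite addnA.
case: (x =P s) tailE => [->|xs] /= tailE; last first.
  by rewrite tailE // addn0 IHp.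
rewrite IHp addn1 in tailE.
by case: (head _ _ == s); rewrite /= ?tailE // take0 /= addn1.
Qed.

(** The places of the letter true in a word cut it into blocks that end with
true, and the differences of these places are the sizes of the blocks. *)
Lemma differences_mask s b k :
  flatten [seq rcons (nseq a.-1 (~~ s)) s
          | a <- pairmap (fun x y => y - x)%N k
                   (mask (rcons b true) (iota k.+1 (size b).+1))] =
  [seq if z then s else ~~ s | z <- rcons b true].
Proof.
elim: b k => [|z b IHb] k; first by rewrite /= subSnn.
rewrite [size _]/= -[iota _ _]/(k.+1 :: iota k.+2 (size b).+1) rcons_cons.
rewrite map_cons -(IHb k.+1); case: z => /=; first by rewrite subSnn.
case def: (mask (rcons b true) _) => [|y l].
  move/(congr1 size): def; rewrite size_mask ?size_rcons /= ?size_iota //.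
  by rewrite -cats1 count_cat addn1.
have: (k.+1 < y)%N.
  have: y \in mask (rcons b true) (iota k.+2 (size b).+1).
    by rewrite def mem_head.
  by move/mem_mask; rewrite mem_iota => /andP[].
move=> ky /=; have -> // : (y - k).-1 = ((y - k.+1).-1).+1 by lia.
Qed.

Lemma last_nseq (x z : bool) m : last x (nseq m.+1 z) = z.
Proof. by elim: m x => //= m IHm x; apply: IHm. Qed.

Lemma nexts_nseq y s m : nexts y s (nseq m.+1 s) = rcons (nseq m s) y.
Proof. by elim: m => [|m]; rewrite /= eqxx //= => ->. Qed.

Lemma nexts_nseqC y s m : nexts y s (nseq m (~~ s)) = [::].
Proof. by elim: m => //= m ->; case: s. Qed.

Definition zigzag (a d : seq nat) :=
  flatten [seq nseq ad.1 ustep ++ nseq ad.2 dstep | ad <- zip a d].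

(** A run of a steps s gives a - 1 letters s and one letter ~~ s.  In the word
of the downsteps, the default upstep makes the last run like the others. *)
Lemma nexts_zigzag a d :
    size a = size d -> all (ltn 0) a -> all (ltn 0) d ->
  [/\ head ustep (zigzag a d) = ustep, last dstep (zigzag a d) = dstep,
      nexts dstep ustep (zigzag a d) =
        flatten [seq rcons (nseq x.-1 ustep) dstep | x <- a]
    & nexts ustep dstep (zigzag a d) =
        flatten [seq rcons (nseq x.-1 dstep) ustep | x <- d]].
Proof.
rewrite /zigzag; elim: a d => [|x a IHa] [|y d] // [ad] xa yd.
case/andP: xa => x0 a0; case/andP: yd => y0 d0.
have [hz lz hu hd] := IHa d ad a0 d0; case: x y x0 y0 => [|x] [|y] // _ _.
have flattenE (v : seq bool) vs : flatten (v :: vs) = v ++ flatten vs by [].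
rewrite [zip _ _]/= !map_cons !flattenE.
split=> //; rewrite ?nexts_cat ?hu ?hd ?hz ?nexts_nseq ?nexts_nseqC ?cats0 //.
by rewrite !last_cat last_nseq.
Qed.

Lemma rcons_labels b :
  rcons (mask (rcons b false) (iota 1 (size b).+1)) (size b).+1 =
  mask (rcons b true) (iota 1 (size b).+1).
Proof.
have -> : iota 1 (size b).+1 = rcons (iota 1 (size b)) (size b).+1.
  by rewrite -[(size b).+1]addn1 iotaD cats1 addnC.
by rewrite !mask_rcons ?size_iota //= cats0 cats1.
Qed.

(** The partial sums A of the ascents of L p are the places of d in e, so the
blocks of upsteps of L p spell out e; likewise its blocks of downsteps spell out
c.  The value n.+1 that closes both lists of partial sums accounts for the last
letters. *)
Lemma follow_L n p c e : dyck n.+1 p -> follow n p c e -> follow n (L p) e c.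
Proof.
move=> pd hf; have [cu cd] := follow_count hf; have b0 := follow_height hf.
have [hp hc he sc se] := hf.
have hn : nexts ustep dstep p = rcons e ustep.
  have [w pw] := dyck_ends pd; move: he; rewrite pw -rcons_cons !nexts_rcons /=.
  by rewrite !cats1 => /rcons_inj[->].
pose bA := [seq z == dstep | z <- e]; pose bD := [seq z == ustep | z <- c].
have := rcons_labels bA; have := rcons_labels bD.
rewrite /L cu !double_labels_mask cu cd hn hc !map_rcons -/bA -/bD.
rewrite !size_map sc se.
rewrite /path_of_code => -> ->.
have pos b : all (ltn 0) (differences (mask b (iota 1 n.+1))).
  apply: differences_gt0; apply: path_mask; first exact: ltn_trans.
  exact: (iota_ltn_sorted 0 n.+2).
set a := differences (mask (rcons bA true) _).
set d := differences (mask (rcons bD true) _).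
have ad : size a = size d.
  rewrite !size_pairmap !size_mask ?size_rcons ?size_iota ?size_map ?sc ?se //.
  rewrite -!cats1 !count_cat !count_map; congr (_ + _)%N.
  rewrite -[LHS]/(count_mem dstep e) -[RHS]/(count_mem ustep c).
  have := size_steps c; have := size_steps e; move: b0; rewrite !heightE sc se.
  lia.
have [hz lz hu hd] := nexts_zigzag ad (pos _) (pos _).
rewrite -/(zigzag a d); move: hz lz hu hd.
have := differences_mask dstep bA 0; have := differences_mask ustep bD 0.
rewrite !size_map sc se -/a -/d => -> -> .
rewrite !map_rcons -!map_comp.
have idE f (w : seq bool) : f =1 id -> map f w = w.
  by move=> fz; rewrite (eq_map fz) map_id.
rewrite !idE; try by case.
case/lastP: (zigzag a d) => [|w z]; first by case: (e).
rewrite last_rcons => hz zd; rewrite {}zd in hz * => hu.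
rewrite nexts_rcons /= cats1 => /rcons_inj[hd].
split=> //; last by rewrite nexts_rcons /= cats1 hd.
by case: (w) hz.
Qed.

(** * The woven path *)

Fixpoint interleave (a b : seq bool) : seq bool :=
  match a, b with
  | x :: a', y :: b' => x :: y :: interleave a' b'
  | _, _ => [::]
  end.

Lemma size_interleave a b :
  size a = size b -> size (interleave a b) = (size a).*2.
Proof. by elim: a b => [|x a IHa] [|y b] //= [/IHa->]. Qed.

Lemma interleave_cat a b a' b' : size a = size b ->
  interleave (a ++ a') (b ++ b') = interleave a b ++ interleave a' b'.
Proof. by elim: a b => [|x a IHa] [|y b] //= [/IHa->]. Qed.

Lemma interleave_rcons a b x y : size a = size b ->
  interleave (rcons a x) (rcons b y) = rcons (rcons (interleave a b) x) y.
Proof. by move=> ab; rewrite -!cats1 interleave_cat // -catA. Qed.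

Lemma interleave_shift a b x y : size a = size b ->
  interleave (x :: a) (rcons b y) = x :: rcons (interleave b a) y.
Proof. by elim: a b x => [|z a IHa] [|t b] x //= [ab]; rewrite -IHa. Qed.

Lemma height_take_interleave a b k : size a = size b ->
  height (take k.*2 (interleave a b)) = height (take k a) + height (take k b).
Proof.
elim: k a b => [|k IHk] [|x a] [|y b] //= [ab].
by rewrite IHk //; lia.
Qed.

Lemma dyck_nil p : dyck 0 p -> p = [::].
Proof.
by case: p => [|[] p] // /andP[/height_take_dyck[_ /(_ 1%N)]]; rewrite /= take0.
Qed.

(** The final downstep of the second word is dropped, and an upstep is put at
the front; the first word keeps its final downstep. *)
Definition weave (p : seq bool) : seq bool :=
  belast ustep (interleave (nexts dstep ustep p) (nexts dstep dstep p)).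

Lemma follow_weave n p c e : follow n p c e ->
  weave p = ustep :: rcons (interleave c e) dstep.
Proof.
case=> _ hc he sc se.
by rewrite /weave hc he interleave_rcons ?belast_rcons // sc.
Qed.

Lemma weave_inj n p q : dyck n p -> dyck n q -> weave p = weave q -> p = q.
Proof.
case: n => [|n] pd qd.
  by rewrite (dyck_nil pd) (dyck_nil qd).
have [c [e hp]] := dyck_follow pd; have [c' [e' hq]] := dyck_follow qd.
rewrite (follow_weave hp) (follow_weave hq) => -[/rcons_inj[ce]].
suff [ec ee] : c = c' /\ e = e' by apply: follow_inj hp _; rewrite ec ee.
case: hp hq => _ _ _ sc se [_ _ _ sc' se']; rewrite -{}sc in se sc' se'.
elim: c e c' e' ce se sc' se' {pd qd}
  => [|x c IHc] [|y e] [|x' c'] [|y' e'] //=.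
by case=> -> -> h [se] [sc'] [se']; have [||||-> ->] := IHc e c' e'.
Qed.

(** The heights at odd abscissas are 1 plus the sums in admissible, and the
height at an even abscissa is at most 1 lower than the one before it. *)
Lemma dyck_weave n p : dyck n p -> dyck n (weave p).
Proof.
case: n => [/dyck_nil-> //|n] pd.
have [c [e hf]] := dyck_follow pd; have adm := (follow_dyck hf).1 pd.
have b0 := follow_height hf; have [_ _ _ sc se] := hf.
rewrite (follow_weave hf).
have sce : size c = size e by rewrite sc.
have sI := size_interleave sce.
have bI : height (interleave c e) = 0.
  have := height_take_interleave n sce.
  by rewrite !take_oversize ?sI ?sc ?se ?b0.
have bW : height (ustep :: rcons (interleave c e) dstep) = 0.
  by rewrite /= height_rcons bI.
have sW : size (ustep :: rcons (interleave c e) dstep) = n.+1.*2.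
  by rewrite /= size_rcons sI sc.
rewrite /dyck; apply/andP; split; last first.
  have := size_steps (ustep :: rcons (interleave c e) dstep).
  by move: bW; rewrite heightE sW; lia.
apply/height_take_dyck; split=> // -[|i]; first by rewrite take0.
rewrite /=; case: (ltnP i (size (interleave c e)).+1) => iI; last first.
  by rewrite take_oversize ?size_rcons // height_rcons bI.
rewrite -cats1 takel_cat //.
have iE := odd_double_half i.
have := adm i./2; rewrite -height_take_interleave // -[in take i _]iE.
move: iE; case: (odd i) => /= iE; last by rewrite add0n /step; lia.
rewrite add1n => hk; have ik : (i./2.*2 < size (interleave c e))%N by lia.
rewrite (take_nth dstep) // height_rcons.
by move: hk; case: (nth _ _ _); rewrite /step; lia.
Qed.

(** Cut w, read from height z, into pairs of steps and exchange the two steps of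
each pair: this turns a peak between two steps of a pair into a valley and vice
versa.  The pairs that start on the ground are kept, since ud would otherwise
become du. *)
Fixpoint flip_pairs (z : int) (w : seq bool) : seq bool :=
  if w is a :: w1 then
    if w1 is b :: w2 then
      (if z == 0 then [:: a; b] else [:: b; a])
        ++ flip_pairs (z + step a + step b) w2
    else w
  else w.

Lemma flip_pairs_interleave z a b w : size a = size b ->
    (forall x, (x < size a)%N ->
      z + (height (take x a) + height (take x b)) != 0) ->
  flip_pairs z (interleave a b ++ w) =
  interleave b a ++ flip_pairs (z + (height a + height b)) w.
Proof.
elim: a b z => [|x a IHa] [|y b] z //= => [_ _|[ab] nz].
  by rewrite !addr0.
have := nz 0%N isT; rewrite /= !addr0 => /negPf ->.
rewrite IHa // => [|k ka]; first by congr [:: _, _ & _ ++ flip_pairs _ _]; lia.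
have := nz k.+1 ka; rewrite /=; congr (~~ (_ == _)); lia.
Qed.

Lemma height_flip_pairs_even z w k :
  height (take k.*2 (flip_pairs z w)) = height (take k.*2 w).
Proof.
elim: k z w => [|k IHk] z w; first by rewrite !take0.
by case: w => [|a [|b w]] //=; case: eqP => _ /=; rewrite IHk //; lia.
Qed.

Lemma height_flip_pairs_odd z w k : (k.*2.+1 < size w)%N ->
  height (take k.*2.+1 (flip_pairs z w)) =
  if z + height (take k.*2 w) == 0 then height (take k.*2.+1 w)
  else height (take k.*2 w) + height (take k.*2.+2 w) - height (take k.*2.+1 w).
Proof.
elim: k z w => [|k IHk] z [|a [|b w]] // kw.
  by rewrite /= !take0 /= addr0; case: eqP => _ /=; rewrite ?take0 /=; lia.
have := IHk (z + step a + step b) w kw; rewrite /= => IH.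
have -> : z + (step a + (step b + height (take k.*2 w))) =
    z + step a + step b + height (take k.*2 w) by rewrite !addrA.
by case: (z =P 0) => _ /=; rewrite IH; case: eqP => _; rewrite ?doubleS; lia.
Qed.

(** After the first upstep the pairs start at odd heights, so that all of them
are exchanged. *)
Lemma weave_L n p :
  dyck n.+1 p -> weave (L p) = ustep :: flip_pairs 1 (behead (weave p)).
Proof.
move=> pd; have [c [e hf]] := dyck_follow pd; have adm := (follow_dyck hf).1 pd.
have [_ _ _ sc se] := hf.
rewrite (follow_weave hf) (follow_weave (follow_L pd hf)) /= -!cats1.
rewrite flip_pairs_interleave ?sc ?se // => x _.
by have := adm x; lia.
Qed.

Lemma admissibleC c e : admissible c e -> admissible e c.
Proof. by move=> adm x; rewrite addrC. Qed.

Lemma dyck_L n p : dyck n p -> dyck n (L p).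
Proof.
case: n => [/dyck_nil-> //|n] pd; have [c [e hf]] := dyck_follow pd.
apply/(follow_dyck (follow_L pd hf)); apply: admissibleC.
exact/(follow_dyck hf).
Qed.

Lemma L_involutive n p : dyck n p -> L (L p) = p.
Proof.
case: n => [/dyck_nil-> //|n] pd; have [c [e hf]] := dyck_follow pd.
apply: follow_inj (follow_L (dyck_L pd) (follow_L pd hf)) hf.
Qed.

(** * Decomposition into components and the derivative *)

Lemma flatten_map_cons (T S : Type) (f : T -> seq S) x s :
  flatten (map f (x :: s)) = f x ++ flatten (map f s).
Proof. by []. Qed.

Lemma is_dyck_cat p q : is_dyck p -> is_dyck q -> is_dyck (p ++ q).
Proof.
move=> /height_take_dyck[p0 pp] /height_take_dyck[q0 qp].
apply/height_take_dyck.
split=> [|i]; first by rewrite height_cat p0 q0.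
by rewrite take_cat; case: ifP => _ //; rewrite height_cat p0 add0r.
Qed.

Lemma is_dyck_elevate q : is_dyck q -> is_dyck (elevate q).
Proof.
move=> /height_take_dyck[q0 qp]; apply/height_take_dyck.
split=> [|[|i]] //=; first by rewrite height_rcons q0.
case: (ltnP i (size q).+1) => iq.
  by rewrite -cats1 takel_cat //; have := qp i; rewrite /step; lia.
by rewrite take_oversize ?size_rcons // height_rcons q0.
Qed.

Lemma first_return p : is_dyck p -> p != [::] ->
  exists q r, [/\ p = elevate q ++ r, is_dyck q & is_dyck r].
Proof.
case/height_take_dyck; case: p => [|x p] //= p0 pp _.
have x1 : x = ustep by have := pp 1%N; rewrite /= take0 /=; case: (x).
rewrite {}x1 /= in p0 pp *.
have ex : exists i, height (take i p) < 0.
  by exists (size p); rewrite take_size; move: p0; rewrite /step; lia.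
case: (ex_minnP ex) => -[|i]; first by rewrite take0.
case: (ltnP i (size p)) => ip; last first.
  rewrite take_oversize ?(leq_trans ip) // => pneg /(_ i).
  by rewrite take_oversize // => /(_ pneg); rewrite ltnn.
rewrite (take_nth dstep) // height_rcons => neg minp.
have pos j : (j <= i)%N -> 0 <= height (take j p).
  by move=> ji; rewrite leNgt; apply/negP => /minp; lia.
have [nd bi] : nth dstep p i = dstep /\ height (take i p) = 0.
  by have := pos i (leqnn i); move: neg; case: (nth _ _ _); rewrite /step; lia.
have pE : p = rcons (take i p) dstep ++ drop i.+1 p.
  by rewrite -nd -take_nth // cat_take_drop.
exists (take i p), (drop i.+1 p); split; first by rewrite /elevate /= -pE.
  apply/height_take_dyck; split=> // j; case: (leqP j i) => ji.
    by rewrite take_takel // pos.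
  by rewrite take_oversize ?bi // size_takel // ltnW.
apply/height_take_dyck; split=> [|j].
  by move: p0; rewrite {1}pE height_cat height_rcons bi /step; lia.
have := pp (i.+2 + j)%N; rewrite addSn /= {1}pE.
have si : size (take i p) = i by rewrite size_takel // ltnW.
rewrite take_cat size_rcons si; case: ifP => [|_]; first by lia.
by rewrite addKn height_cat height_rcons bi /step; lia.
Qed.

Lemma dyck_components p : is_dyck p ->
  exists2 Ps, all is_dyck Ps & p = flatten (map elevate Ps).
Proof.
have [m] := ubnP (size p); elim: m p => // m IHm p pm pd.
have [->|p0] := eqVneq p [::]; first by exists [::].
have [q [r [pE qd rd]]] := first_return pd p0.
have [|Ps Pd rE] := IHm r _ rd.
  by move: pm; rewrite pE size_cat /=; lia.
by exists (q :: Ps); rewrite /= ?qd // -rE.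
Qed.

Lemma is_dyckE p : is_dyck p = dyck (count_mem ustep p) p.
Proof. by rewrite /dyck eqxx andbT. Qed.

Lemma is_dyck_L q : is_dyck q -> is_dyck (L q).
Proof. by rewrite {1}is_dyckE => /dyck_L/andP[]. Qed.

Lemma count_L q : is_dyck q -> count_mem ustep (L q) = count_mem ustep q.
Proof. by rewrite {1}is_dyckE => /dyck_L/andP[_ /eqP]. Qed.

Lemma dyck_flatten_elevate Ps :
  all is_dyck Ps -> is_dyck (flatten (map elevate Ps)).
Proof.
elim: Ps => [|q Ps IHPs] // /andP[qd Pd]; rewrite flatten_map_cons.
exact: is_dyck_cat (is_dyck_elevate qd) (IHPs Pd).
Qed.

Lemma all_dyck_L Ps : all is_dyck Ps -> all is_dyck (map L Ps).
Proof. by rewrite all_map; apply: sub_all => q; apply: is_dyck_L. Qed.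

Lemma L'_elevate Ps : all is_dyck Ps ->
  L' (flatten (map elevate Ps)) = flatten (map elevate (map L Ps)).
Proof. by move=> Pd; rewrite L'_flatten // -map_comp. Qed.

Lemma dyck_L' n p : dyck n p -> dyck n (L' p).
Proof.
rewrite /dyck => /andP[/dyck_components[Ps Pd ->] /eqP <-].
rewrite L'_elevate // dyck_flatten_elevate ?all_dyck_L //.
apply/eqP; elim: Ps Pd => [|q Ps IHPs] // /andP[qd Pd].
rewrite map_cons !flatten_map_cons !count_cat IHPs // /elevate /=.
by rewrite -!cats1 !count_cat count_L.
Qed.

Lemma L'_involutive n p : dyck n p -> L' (L' p) = p.
Proof.
case/andP=> /dyck_components[Ps Pd ->] _.
rewrite !L'_elevate ?all_dyck_L //; congr flatten; congr map.
elim: Ps Pd => //= q Ps IHPs /andP[qd Pd].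
by rewrite IHPs // (@L_involutive (count_mem ustep q)) // -is_dyckE.
Qed.

(** Elevation puts an upstep in front of c and a downstep behind e.  This shifts
the weaving by one step, so that e_i now comes before c_i, as it does in the
woven path of L q. *)
Lemma weave_elevate n q : dyck n q -> weave (elevate q) = elevate (weave (L q)).
Proof.
case: n => [/dyck_nil-> //|n] qd; have [c [e hf]] := dyck_follow qd.
rewrite (follow_weave (follow_L qd hf)); have [hq hc he sc se] := hf.
rewrite /weave /elevate.
have -> : nexts dstep ustep (ustep :: rcons q dstep) = ustep :: rcons c dstep.
  by rewrite /= nexts_rcons hc cats0; case: (q) hq => [|x q'] //= ->.
have -> : nexts dstep dstep (ustep :: rcons q dstep) =
    rcons (rcons e dstep) dstep.
  by rewrite /= nexts_rcons he cats1.
rewrite interleave_shift ?size_rcons ?sc ?se // -rcons_cons belast_rcons.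
by rewrite interleave_rcons ?sc ?se.
Qed.

Lemma belast_interleave_cat a b a' b' z x y : size a = (size b).+1 ->
  belast z (interleave (a ++ a') (rcons b x ++ b')) =
  belast z (interleave a (rcons b y)) ++ belast x (interleave a' b').
Proof.
case/lastP: a => [|a t] //; rewrite size_rcons => -[ab].
rewrite interleave_cat ?size_rcons ?ab // !interleave_rcons //.
by rewrite belast_cat !belast_rcons last_rcons.
Qed.

(** If r is nonempty, the last downstep of elevate q is followed by an upstep,
and this is the upstep at the front of weave r. *)
Lemma weave_cat q r : is_dyck q -> is_dyck r ->
  weave (elevate q ++ r) = weave (elevate q) ++ weave r.
Proof.
move=> qd rd; have [->|r0] := eqVneq r [::]; first by rewrite !cats0.
have hr : head dstep r = ustep.
  by have [q' [r' [-> _ _]]] := first_return rd r0.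
have nu y : nexts y ustep (elevate q) = nexts dstep ustep (ustep :: q).
  by rewrite /elevate -rcons_cons nexts_rcons cats0.
have nd y :
    nexts y dstep (elevate q) = rcons (nexts dstep dstep (ustep :: q)) y.
  by rewrite /elevate -rcons_cons nexts_rcons cats1.
rewrite /weave !nexts_cat hr !nu !nd; apply: belast_interleave_cat.
have /andP[/eqP cnt _] := is_dyck_elevate qd.
by rewrite -(nu dstep) size_nexts cnt -(size_nexts dstep) nd size_rcons.
Qed.

Lemma weave_flatten Ps : all is_dyck Ps ->
  weave (flatten (map elevate Ps)) =
  flatten [seq elevate (weave (L P)) | P <- Ps].
Proof.
elim: Ps => [|q Ps IHPs] // /andP[qd Pd].
rewrite !flatten_map_cons weave_cat ?dyck_flatten_elevate // IHPs //.
congr (_ ++ _); apply: (@weave_elevate (count_mem ustep q)).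
by rewrite -is_dyckE.
Qed.

(** The first pair is uu (or the whole component ud), and the following ones are
the pairs (e_i, c_i), which start at height at least 2. *)
Lemma flip_pairs_elevate n q w : dyck n q ->
  flip_pairs 0 (elevate (weave (L q)) ++ w) =
  elevate (weave q) ++ flip_pairs 0 w.
Proof.
case: n => [/dyck_nil-> //|n] qd; have [c [e hf]] := dyck_follow qd.
rewrite (follow_weave (follow_L qd hf)) (follow_weave hf).
have adm := (follow_dyck hf).1 qd; have b0 := follow_height hf.
have [_ _ _ sc se] := hf.
rewrite /elevate !rcons_cons -!interleave_rcons ?sc ?se // !cat_cons /=.
rewrite flip_pairs_interleave ?size_rcons ?sc ?se // => [|x xn].
  rewrite !height_rcons; congr [:: _, _ & _ ++ flip_pairs _ _].
  by rewrite /step; lia.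
rewrite -!cats1 !takel_cat ?sc ?se //.
by have := adm x; rewrite /step; lia.
Qed.

(** By weave_flatten, the components of weave (L' p) are the paths
elevate (weave (L (L q))) = elevate (weave q). *)
Lemma weave_L' n p : dyck n p -> weave (L' p) = flip_pairs 0 (weave p).
Proof.
case/andP=> /dyck_components[Ps Pd ->] _.
rewrite L'_elevate // !weave_flatten ?all_dyck_L //.
elim: Ps Pd => [|q Ps IHPs] // /andP[qd Pd]; rewrite is_dyckE in qd.
rewrite map_cons !flatten_map_cons (flip_pairs_elevate _ qd) IHPs //.
by rewrite (L_involutive qd).
Qed.

(** * The reverse path *)

Lemma height_R w : height (R w) = - height w.
Proof.
rewrite /R; elim: w => //= b w IHw; rewrite rev_cons height_rcons IHw.
by case: b; rewrite /step /=; lia.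
Qed.

Lemma size_R w : size (R w) = size w.
Proof. by rewrite size_rev size_map. Qed.

Lemma R_cons b w : R (b :: w) = rcons (R w) (~~ b).
Proof. by rewrite /R /= rev_cons. Qed.

Lemma R_rcons w b : R (rcons w b) = ~~ b :: R w.
Proof. by rewrite /R map_rcons rev_rcons. Qed.

Lemma height_take_R w i :
  height w = 0 -> height (take i (R w)) = height (take (size w - i) w).
Proof.
rewrite -{1}(cat_take_drop (size w - i) w) height_cat => w0.
by rewrite /R take_rev size_map -map_drop -/(R _) height_R; lia.
Qed.

Lemma dyck_R n p : dyck n p -> dyck n (R p).
Proof.
case/andP=> /height_take_dyck[p0 pp] /eqP pn; apply/andP; split.
  apply/height_take_dyck; split=> [|i]; first by rewrite height_R p0.
  by rewrite height_take_R.
rewrite /R count_rev count_map -pn; apply/eqP.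
move: p0; rewrite heightE => p0.
have -> : count (preim negb (pred1 ustep)) p = count_mem dstep p.
  by apply: eq_count => -[].
lia.
Qed.

Fixpoint prevs (x0 s : bool) (p : seq bool) : seq bool :=
  if p is x :: p' then
    if x == s then x0 :: prevs x s p' else prevs x s p'
  else [::].

Lemma nexts_R y s p : nexts y s (R p) = R (prevs (~~ y) (~~ s) p).
Proof.
elim: p y => //= x p IHp y; rewrite R_cons nexts_rcons IHp negbK.
by case: x s {IHp} => -[] /=; rewrite ?cats0 ?R_cons ?negbK ?cats1.
Qed.

(** The step before an s is s exactly when the previous s is followed by s; so
the words of preceding and following steps differ only by a shift. *)
Lemma prevs_nexts x0 y s p : (last x0 p == y) || (y == ~~ s) ->
  rcons (prevs x0 s p) y =
  (if head y p == s then x0 else ~~ s) :: nexts y s p.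
Proof.
elim: p x0 => [|x p IHp] x0 /=.
  by case: y s x0 => -[] -[].
move/IHp=> IH; case: (x =P s) => [xs|/eqP xs] /=; rewrite IH.
  by rewrite xs; case: (s); case: (head y p).
by case: x s xs {IHp IH} => -[] //= _; case: (head y p).
Qed.

Lemma follow_R n p c e : dyck n.+1 p -> follow n p c e ->
  follow n (R p) (R e) (R c).
Proof.
move=> pd [hp hc he sc se]; have [w pw] := dyck_ends pd.
have lp : last ustep p = dstep by rewrite pw /= last_rcons.
have := @prevs_nexts ustep dstep dstep p.
have := @prevs_nexts ustep dstep ustep p.
rewrite hp hc he /= -!rcons_cons orbT => /(_ isT)/rcons_inj[pu].
rewrite lp => /(_ isT)/rcons_inj[pdn].
split; rewrite ?size_R // ?nexts_R ?pu ?pdn ?R_cons //.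
by rewrite pw R_cons R_rcons.
Qed.

Lemma R_interleave a b : size a = size b ->
  R (interleave a b) = interleave (R b) (R a).
Proof.
elim: a b => [|x a IHa] [|y b] //= [ab].
by rewrite !R_cons IHa // interleave_rcons ?size_R.
Qed.

Lemma weave_R n p : dyck n p -> weave (R p) = R (weave p).
Proof.
case: n => [/dyck_nil-> //|n] pd; have [c [e hf]] := dyck_follow pd.
have [_ _ _ sc se] := hf.
rewrite (follow_weave (follow_R pd hf)) (follow_weave hf) R_cons R_rcons.
by rewrite R_interleave // sc.
Qed.

(** * The woven path as a wave *)

Fixpoint half_steps (p : seq bool) (t : nat) : seq bool :=
  if t is t'.+1 then
    if odd t' then L' (half_steps p t') else L (half_steps p t')
  else p.

Lemma dyck_half_steps n p t : dyck n p -> dyck n (half_steps p t).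
Proof.
by move=> pd; elim: t => //= t IHt; case: odd; [apply: dyck_L'|apply: dyck_L].
Qed.

Lemma half_steps_even p k : half_steps p k.*2 = iter k (L' \o L) p.
Proof. by elim: k => //= k <-; rewrite odd_double. Qed.

Lemma dyck_weave_facts n p : dyck n p ->
  [/\ size (weave p) = n.*2, height (weave p) = 0
    & forall i, 0 <= height (take i (weave p))].
Proof.
move/dyck_weave/andP=> [/height_take_dyck[b0 pre] /eqP qn]; split=> //.
by rewrite -size_steps qn; move: b0; rewrite heightE qn; lia.
Qed.

Lemma height_parity i w : (i <= size w)%N ->
  exists k : int, height (take i w) = i%:Z + k + k.
Proof.
move=> iw; exists (- (count_mem dstep (take i w))%:Z).
by have := size_steps (take i w); rewrite size_takel // heightE; lia.
Qed.

Lemma step_abs w i : (i < size w)%N ->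
  `|height (take i.+1 w) - height (take i w)| = 1.
Proof.
move=> iw; rewrite (take_nth dstep) // height_rcons.
by case: (nth _ _ _); rewrite /step; lia.
Qed.

(** Exchanging two steps around a vertex replaces its height y, between x and z,
by x + z - y.  This is nonnegative as a height of the woven path of L p. *)
Lemma wave_L n p i : dyck n p -> (i <= n.*2)%N ->
  height (take i (weave (L p))) =
  if odd i || (i == 0)%N || (i == n.*2)%N then height (take i (weave p))
  else `|height (take i.-1 (weave p)) + height (take i.+1 (weave p))
         - height (take i (weave p))|.
Proof.
case: n => [|n] pd i2.
  by move: i2; rewrite leqn0 => /eqP->; rewrite !take0.
have [sq bq preq] := dyck_weave_facts pd.
have [sl bl prel] := dyck_weave_facts (dyck_L pd).
case: (i =P n.+1.*2) => [->|ni].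
  by rewrite orbT !take_oversize ?sq ?sl // bq bl.
have := weave_L pd; have := prel i.
have [c [e hf]] := dyck_follow pd; rewrite (follow_weave hf) in sq preq *.
case: i {bq bl prel} i2 ni => [|i] i2 ni; first by rewrite !take0.
move=> pre0 ql; rewrite ql /= in pre0 *; rewrite !orbF.
move: (rcons _ _) sq preq pre0 => w /= [sw] prew.
have := odd_double_half i; case: (odd i) => /= iE pre0; last first.
  by rewrite -iE add0n height_flip_pairs_even.
rewrite -iE add1n in pre0 *; move: pre0.
rewrite height_flip_pairs_odd; last by lia.
(* a pair starts at an odd height, hence not on the ground *)
have [|k hk] := @height_parity i./2.*2 w; first by lia.
case: eqP => [h|_]; first by lia.
have := prew i./2.*2.+2 => /=.
by rewrite /step; lia.
Qed.

(** A pair that starts on the ground and is kept has its middle vertex at height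
1, followed by height 0 or 2; then |0 + 0 - 1| = 0 + 2 - 1 = 1. *)
Lemma wave_L' n p i : dyck n p -> (i <= n.*2)%N ->
  height (take i (weave (L' p))) =
  if odd i then
    `|height (take i.-1 (weave p)) + height (take i.+1 (weave p))
      - height (take i (weave p))|
  else height (take i (weave p)).
Proof.
move=> pd i2; have [sq bq preq] := dyck_weave_facts pd.
have [_ _ prel] := dyck_weave_facts (dyck_L' pd).
have := prel i; rewrite (weave_L' pd); have := odd_double_half i.
case: (odd i) => /= iE; last by rewrite -iE add0n height_flip_pairs_even.
rewrite -iE add1n /= height_flip_pairs_odd; last by lia.
rewrite add0r; case: eqP => [h0 _|_]; last by lia.
have := preq i./2.*2.+2; have := preq i./2.*2.+1.
have := @step_abs (weave p) i./2.*2; have := @step_abs (weave p) i./2.*2.+1.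
by rewrite h0; lia.
Qed.

(** The first n iterations provide the past that wave_reversal requires. *)
Lemma iter_reversal n p : dyck n p ->
  iter n (L' \o L) (iter n (L' \o L) p) = R (iter n (L' \o L) p).
Proof.
move=> pd; pose h t i := height (take i (weave (half_steps p t))).
have facts t := dyck_weave_facts (dyck_half_steps t pd).
have hE t i : (i <= n.*2)%N -> h t.+1 i =
    if (odd t == odd i) && (0 < i < n.*2)%N
    then `|h t i.-1 + h t i.+1 - h t i| else h t i.
  move=> i2; rewrite /h /=; case: (boolP (odd t)) => ot.
    rewrite (wave_L' (dyck_half_steps t pd)) //.
    case: (boolP (odd i)) => oi //=.
    by case: ifP => // /negP[]; lia.
  rewrite (wave_L (dyck_half_steps t pd)) //; case: (odd i) => //=.
  by case: i i2 => //= i i2; rewrite ltn_neqAle i2 andbT; case: eqP.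
have dS k : dyck n (iter k (L' \o L) p).
  by rewrite -half_steps_even dyck_half_steps.
rewrite -iterD addnn; apply: (weave_inj (dS _) (dyck_R (dS _))).
rewrite (weave_R (dS _)) -!half_steps_even.
have [s1 b1 _] := facts n.*2; have [s2 b2 _] := facts n.*2.*2.
have main i : (i <= n.*2)%N ->
    height (take i (weave (half_steps p n.*2.*2))) =
    height (take i (R (weave (half_steps p n.*2)))).
  move=> i2; rewrite height_take_R // s1.
  have := @wave_reversal n.*2 h _ _ _ _ _ _ _ n.*2 (n.*2 - i)%N.
  rewrite subKn // addnn; apply; rewrite ?odd_double ?leq_subr //.
  - by move=> t; rewrite /h take0.
  - move=> t; rewrite /h; have [st bt _] := facts t.
    by rewrite take_oversize ?st.
  - by move=> t j _; rewrite /h; have [] := facts t.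
  - by move=> t j jn; rewrite /h step_abs //; have [-> _ _] := facts t.
  - by move=> t j jn /negPf tj; rewrite hE // tj.
  - by move=> t j jn tj; rewrite hE ?tj ?jn //; lia.
apply: (@eq_from_nth _ dstep) => [|i]; rewrite s2 ?size_R ?s1 // => i2.
have := main i.+1 i2; rewrite !(take_nth dstep) ?size_R ?s1 ?s2 //.
rewrite !height_rcons main 1?ltnW // => /addrI.
by case: (nth _ _ _) (nth _ (R _) _) => -[].
Qed.

Theorem mainTheorem2 (n : nat) (P : seq bool) (hP : dyck n P) :
  iter n (L' \o L) P = R P.
Proof.
pose p := iter n (L \o L') P.
have back k : dyck n (iter k (L \o L') P) /\
    iter k (L' \o L) (iter k (L \o L') P) = P.
  elim: k => [|k [dk IHk]] //; split; first exact/dyck_L/dyck_L'.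
  by rewrite iterSr /= (L_involutive (dyck_L' dk)) (L'_involutive dk).
have [pd pP] := back n.
by have := iter_reversal pd; rewrite pP.
Qed.
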